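(* Let $d\ge1$ and let $b\in C^1_\sharp(Y_d)^d$. There exists a probability measure on $Y_d$ which is invariant for the flow $T_t$ associated with $b$. Moreover, let $g\in C^0_\sharp(Y_d)$ and $x\in\mathbb{R}^d$ be fixed, and let $(t_n)_{n\in\mathbb{N}}\in\mathbb{R}^{\mathbb{N}}$ be such that $\lim_n t_n=\infty$. Then, for any limit point $a$ of the real sequence $(u_n)_{n\in\mathbb{N}}$ defined by $$u_n:=\frac1{t_n}\int_0^{t_n}g(X(s,x))\,ds,\quad n\in\mathbb{N},$$ there exists a probability measure $\mu\in\mathscr{M}_p(Y_d)$ (depending a priori on $x$ and $g$) which is invariant for the flow $T_t$ and satisfies $$a=\int_{Y_d}g(y)\,d\mu(y).$$
   Context: $Y_d:=\mathbb{R}^d/\mathbb{Z}^d$ is the $d$-dimensional torus, identified with the cube $[0,1)^d$. $C^k_\sharp(Y_d)$ is the space of real-valued functions in $C^k(\mathbb{R}^d)$ which are $\mathbb{Z}^d$-periodic. $\mathscr{M}_p(Y_d)$ is the space of (Borel) probability measures on $Y_d$. A limit point of a sequence means the limit of one of its subsequences. For $b\in C^1_\sharp(Y_d)^d$ and $x\in\mathbb{R}^d$, $X(\cdot,x)$ denotes the unique solution, defined on all of $\mathbb{R}$ with values in $\mathbb{R}^d$, of $\frac{\partial X}{\partial t}(t,x)=b(X(t,x))$ for $t\in\mathbb{R}$, $X(0,x)=x$. It satisfies $X(t,x+k)=X(t,x)+k$ for $k\in\mathbb{Z}^d$. The associated flow $(T_t)_{t\in\mathbb{R}}$ is $T_t(\varphi)(x):=\varphi(X(t,x))$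 for $\varphi\in C^0_\sharp(Y_d)$, $x\in\mathbb{R}^d$. A measure $\mu\in\mathscr{M}_p(Y_d)$ is invariant for the flow $T_t$ if for all $t\in\mathbb{R}$ and all $\psi\in C^0_\sharp(Y_d)$, $\int_{Y_d}\psi(X(t,y))\,d\mu(y)=\int_{Y_d}\psi(y)\,d\mu(y)$. *)

(* Defs.v *)
From HB Require Import structures.
From mathcomp Require Import all_boot all_order all_algebra.
From mathcomp Require Import generic_quotient ring_quotient.
From mathcomp Require Import all_classical all_reals all_analysis.
Import Order.TTheory GRing.Theory Num.Theory.
Import numFieldNormedType.Exports.

Set Implicit Arguments.
Unset Strict Implicit.
Unset Printing Implicit Defensive.

Local Open Scope classical_set_scope.
Local Open Scope ring_scope.
Local Open Scope quotient_scope.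

Section Torus.
Context {R : realType} {d : nat}.

(* The subgroup Z^d of R^d. *)
Definition lattice : pred 'rV[R]_d := fun x => [forall i, x 0 i \is a Num.int].

Lemma lattice_zmod_closed : zmod_closed lattice.
Proof.
split=> [|x y /forallP xZ /forallP yZ]; apply/forallP => i.
  by rewrite mxE rpred0.
by rewrite !mxE rpredB// ?xZ ?yZ.
Qed.

HB.instance Definition _ :=
  GRing.isZmodClosed.Build 'rV[R]_d lattice lattice_zmod_closed.

Definition lattice_zmod : zmodClosed 'rV[R]_d :=
  GRing.ZmodClosed.clone 'rV[R]_d lattice _.

Definition torus : Type := quotient_topology (Quotient.quot lattice_zmod).
HB.instance Definition _ := Quotient.on torus.
HB.instance Definition _ := PointedTopological.on torus.

Definition borel_torus : Type := g_sigma_algebraType (@open torus).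
HB.instance Definition _ := Measurable.on borel_torus.
HB.instance Definition _ := Pointed.on borel_torus.

Definition periodic_Zd (f : 'rV[R]_d -> R) :=
  forall x k : 'rV[R]_d, k \in lattice -> f (x + k) = f x.

Definition partial (i : 'I_d) (f : 'rV[R]_d -> R) : 'rV[R]_d -> R :=
  fun x => 'D_(delta_mx 0 i) f x.

(* C^k(R^d): all partial derivatives of order at most k exist and are
   continuous. *)
Fixpoint Ck (k : nat) (f : 'rV[R]_d -> R) : Prop :=
  continuous f /\
  match k with
  | 0 => True
  | k'.+1 => forall i : 'I_d,
      (forall x, derivable f x (delta_mx 0 i)) /\ Ck k' (partial i f)
  end.

Definition Csharp (k : nat) (f : 'rV[R]_d -> R) := Ck k f /\ periodic_Zd f.

Definition Csharp_vec (k : nat) (b : 'rV[R]_d -> 'rV[R]_d) :=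
  forall i : 'I_d, Csharp k (fun x => b x 0 i).

(* X t x is the value at time t of the solution issued from x; for b in
   Csharp_vec 1 these conditions determine X uniquely. *)
Definition is_solution (b : 'rV[R]_d -> 'rV[R]_d)
    (X : R -> 'rV[R]_d -> 'rV[R]_d) :=
  forall x, X 0 x = x /\ forall t : R, is_derive t 1 (X ^~ x) (b (X t x)).

Definition flow (X : R -> 'rV[R]_d -> 'rV[R]_d) (t : R)
  (phi : 'rV[R]_d -> R) : 'rV[R]_d -> R := fun x => phi (X t x).

(* A Z^d-periodic function on R^d seen as a function on the torus: by
   on_torusE the representative chosen by repr is irrelevant. *)
Definition on_torus (f : 'rV[R]_d -> R) : borel_torus -> R :=
  fun y => f (repr (y : torus)).

Lemma on_torusE (f : 'rV[R]_d -> R) (x : 'rV[R]_d) :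
  periodic_Zd f -> on_torus f (\pi_torus x) = f x.
Proof.
move=> pf; rewrite /on_torus -[in RHS](addrNK (repr (\pi_torus x)) x) addrC.
rewrite pf//.
have := Quotient.idealrBE lattice_zmod x (repr (\pi_torus x)).
by move=> ->; rewrite reprK.
Qed.

Definition torus_integral (mu : probability borel_torus R)
  (f : 'rV[R]_d -> R) : R := \int[mu]_y on_torus f y.

Definition invariant_measure (X : R -> 'rV[R]_d -> 'rV[R]_d)
    (mu : probability borel_torus R) :=
  forall (t : R) (psi : 'rV[R]_d -> R), Csharp 0 psi ->
    torus_integral mu (flow X t psi) = torus_integral mu psi.

End Torus.
Arguments torus : clear implicits.
Arguments borel_torus : clear implicits.

(* Oriented integral, for either order of the endpoints. *)
Definition oriented_integral {R : realType} (a b : R) (f : R -> R) : R :=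
  if a <= b then \int[@lebesgue_measure R]_(s in `[a, b]) f s
  else - \int[@lebesgue_measure R]_(s in `[b, a]) f s.

Definition subsequential_limit {R : realType} (u : R^nat) (a : R) :=
  exists2 phi : nat -> nat, increasing_seq phi & u \o phi @ \oo --> a.

(* Main.v *)
From HB Require Import structures.
Require Import Defs.
From mathcomp Require Import all_boot all_order all_algebra.
From mathcomp Require Import generic_quotient ring_quotient.
From mathcomp Require Import all_classical all_reals all_analysis.
From mathcomp Require Import measurable_realfun ring lra.
Import Order.TTheory GRing.Theory Num.Theory.
Import numFieldNormedType.Exports.
Local Open Scope classical_set_scope.
Local Open Scope ring_scope.
Set Implicit Arguments.
Unset Strict Implicit.
Unset Printing Implicit Defensive.

(** An invariant measure is obtained as a limit of the uniform measures along
    a long piece of orbit (Krylov and Bogolyubov).  For t_n -> +oo, the time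
    averages A_n(f) = (1/t_n) int_0^{t_n} f(X(s,x)) ds are positive,
    normalized linear functionals on the continuous functions of the torus.
    Since the torus is compact, A_n(f) is bounded in n for each f, and its
    limit along one ultrafilter finer than the filter of cofinite sets exists
    for all f at once ([mean_ultralimit]).  The limit functional L is again
    positive, linear and normalized.

    The functional L is invariant because the flow composed with X(.,x) is a
    time shift, f(X(tau, X(s,x))) = f(X(s + tau, x)), and shifting a bounded
    function by tau changes its integral over [0, t_n] by at most
    2 M |tau|, which is negligible after division by t_n
    ([time_average_shift]).  If moreover A_n(g) converges to a in the
    ordinary sense, then L(g) = a.

    Two ingredients give this argument its content.

    First, L must be represented by a Borel measure.  This is the
    Riesz-Markov theorem on a compact Hausdorff space ([riesz_markov]): the
    mass of an open set U is the supremum of L(f) over continuous f with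
    0 <= f <= 1 vanishing off U, its outer regularization is an outer measure
    for which the open sets are Caratheodory measurable, and slicing the range
    of f into n layers compares L(f) with the integral of f up to 1/n.  It
    applies to the torus, which is the image of a cube and is separated by the
    periodic functions sin^2(pi (w_i - v_i)).

    Second, f o X(tau, .) must be continuous and periodic in order that L can
    be evaluated on it.  The partial derivatives of b are continuous and
    periodic, hence bounded, so b is globally Lipschitz
    ([C1_periodic_lipschitz]); Gronwall's lemma applied to the squared
    distance of two solutions ([solutions_close]) then yields continuity in
    the initial point and uniqueness, and uniqueness yields the semigroup law
    and X(t, x + k) = X(t, x) + k. *)

(** * Means on spaces of continuous functions, and the outer measure they induce *)

(** On a compact Hausdorff space these are exactly the integrals against
    probability measures, once restricted to continuous functions. *)
Record mean {R : realType} {T : topologicalType} (L : (T -> R) -> R) : Prop := {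
  meanD : forall f g : T -> R, continuous f -> continuous g ->
    L (fun x => f x + g x) = L f + L g;
  meanZ : forall (c : R) (f : T -> R), continuous f ->
    L (fun x => c * f x) = c * L f;
  mean_ge0 : forall f : T -> R, continuous f -> (forall x, 0 <= f x) -> 0 <= L f;
  mean1 : L (fun=> 1) = 1 }.

Section RieszMarkov.
Context {R : realType} {T : ptopologicalType}.
Variable L : (T -> R) -> R.
Hypothesis mL : mean L.
Implicit Types (c e : R) (f g : T -> R) (U V A B : set T).

Lemma mean_cst c : L (fun=> c) = c.
Proof.
rewrite -[RHS]mulr1 -[in RHS](mean1 mL) -(meanZ mL); last exact: cst_continuous.
by congr L; apply/funext => x; rewrite mulr1.
Qed.

Lemma meanB f g : continuous f -> continuous g ->
  L (fun x => f x - g x) = L f - L g.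
Proof.
move=> cf cg; have cNg : continuous (fun x => -1 * g x).
  by move=> x; apply: cvgM; [exact: cvg_cst|exact: cg].
rewrite -[- L g]mulN1r -(meanZ mL)// -(meanD mL)//.
by congr L; apply/funext => x; rewrite mulN1r.
Qed.

Lemma le_mean f g : continuous f -> continuous g ->
  (forall x, f x <= g x) -> L f <= L g.
Proof.
move=> cf cg fg; rewrite -subr_ge0 -meanB//; apply: (mean_ge0 mL).
  by move=> x; apply: cvgB; [exact: cg|exact: cf].
by move=> x; rewrite subr_ge0.
Qed.

Definition subordinate (U : set T) (f : T -> R) :=
  [/\ continuous f, forall x, 0 <= f x <= 1 & forall x, ~ U x -> f x = 0].

(** Cutting off at level e costs at most e on a mean, and confines the support
    to the closed set where e <= f.  It thereby replaces the compactly supported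
    functions of the classical construction. *)
Definition cutoff (e : R) (f : T -> R) : T -> R := fun x => Num.max (f x - e) 0.

Lemma cutoff_continuous e f : continuous f -> continuous (cutoff e f).
Proof.
move=> cf x; apply: (@continuous_max _ _ (fun x => f x - e) (fun=> 0)).
  by apply: cvgB; [exact: cf|exact: cvg_cst].
exact: cvg_cst.
Qed.

Lemma cutoff_ge0 e f x : 0 <= cutoff e f x.
Proof. by rewrite le_max lexx orbT. Qed.

Lemma cutoff_le e f x : 0 <= e -> 0 <= f x -> cutoff e f x <= f x.
Proof. by move=> e0 f0; rewrite ge_max f0 andbT gerBl. Qed.

Lemma cutoff_eq0 e f x : f x <= e -> cutoff e f x = 0.
Proof. by move=> fe; apply/max_idPr; rewrite subr_le0. Qed.

Lemma mean_cutoff e f : continuous f -> L f <= L (cutoff e f) + e.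
Proof.
move=> cf; rewrite -[X in _ + X]mean_cst -(meanD mL).
- apply: le_mean => //.
    move=> x; apply: cvgD; [exact: cutoff_continuous|exact: cvg_cst].
  by move=> x; rewrite -lerBlDr le_max lexx.
- exact: cutoff_continuous.
- exact: cst_continuous.
Qed.

Lemma subordinate_cutoff U e f : 0 <= e -> subordinate U f ->
  subordinate U (cutoff e f).
Proof.
move=> e0 [cf f01 fU]; split.
- exact: cutoff_continuous.
- move=> x; have /andP[f0 f1] := f01 x.
  by rewrite cutoff_ge0 (le_trans _ f1)// cutoff_le.
- by move=> x /fU fx0; apply: cutoff_eq0; rewrite fx0.
Qed.

Lemma sub_subordinate U V f : U `<=` V -> subordinate U f -> subordinate V f.
Proof. by move=> UV [cf f01 fU]; split=> // x nV; apply: fU => /UV. Qed.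

Lemma closed_superlevel e f : continuous f -> closed [set x | e <= f x].
Proof.
by move=> cf; apply: (@preimage_closed _ _ f [set y | e <= y]).
Qed.

Local Open Scope ereal_scope.

Definition inner_mass (U : set T) : \bar R :=
  ereal_sup [set (L f)%:E | f in subordinate U].

Lemma inner_mass_ubound U f : subordinate U f -> (L f)%:E <= inner_mass U.
Proof. by move=> Uf; apply: ereal_sup_ubound; exists f. Qed.

Lemma le_inner_mass U V : U `<=` V -> inner_mass U <= inner_mass V.
Proof.
move=> UV; apply: ereal_sup_le => _ [f Uf <-]; exists f => //.
exact: sub_subordinate Uf.
Qed.

Lemma subordinate0 U : subordinate U (fun=> 0%R).
Proof. by split=> // [|x]; [exact: cst_continuous|rewrite lexx ler01]. Qed.

Lemma inner_mass_ge0 U : 0 <= inner_mass U.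
Proof.
apply: le_trans (inner_mass_ubound (subordinate0 U)).
by rewrite mean_cst.
Qed.

Lemma inner_massT : inner_mass setT = 1.
Proof.
apply/eqP; rewrite eq_le; apply/andP; split.
  apply: ge_ereal_sup => _ [f [cf f01 _] <-]; rewrite lee_fin.
  rewrite -[leRHS](mean1 mL); apply: le_mean => //; first exact: cst_continuous.
  by move=> x; have /andP[] := f01 x.
rewrite -[leLHS]/(1%:E) -[X in X%:E](mean1 mL); apply: inner_mass_ubound.
by split=> [|x|x []]; [exact: cst_continuous|rewrite lexx ler01|].
Qed.

Lemma inner_mass_le1 U : inner_mass U <= 1.
Proof. by rewrite -inner_massT; exact: le_inner_mass. Qed.

Lemma inner_mass_fin U : inner_mass U \is a fin_num.
Proof.
rewrite ge0_fin_numE; last exact: inner_mass_ge0.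
by apply: le_lt_trans (inner_mass_le1 U) _; rewrite ltry.
Qed.

Lemma inner_mass0 : inner_mass set0 = 0.
Proof.
apply/eqP; rewrite eq_le inner_mass_ge0 andbT.
apply: ge_ereal_sup => _ [f [cf f01 f0] <-].
by rewrite (_ : f = fun=> 0%R) ?mean_cst//; apply/funext => x; exact: f0.
Qed.

Hypothesis hT : hausdorff_space T.
Hypothesis cT : compact [set: T].

(** A function f carried by the union is, up to its cutoff, the sum of f h and
    f (1 - h), where a Urysohn function h that vanishes off U and is 1 on
    {e <= f} minus V makes the first term carried by U and the second by V. *)
Lemma inner_massU U V : open U -> open V ->
  inner_mass (U `|` V) <= inner_mass U + inner_mass V.
Proof.
move=> oU oV; apply: ge_ereal_sup => _ [f [cf f01 fUV] <-].
apply/lee_addgt0Pr => e e0.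
pose K := [set x | (e <= f x)%R].
have sep : uniform_separator (~` U) (K `\` V).
  apply: normal_uniform_separator; first exact: compact_normal.
  - exact: open_closedC.
  - by apply: closedI; [exact: closed_superlevel|exact: open_closedC].
  - apply/seteqP; split=> // x [nU [Kx nV]].
    have := fUV x; rewrite /setU/= => H; have : (f x = 0)%R by apply: H => -[].
    by move=> fx0; move: Kx; rewrite /K/= fx0 leNgt e0.
pose h : T -> R := Urysohn (~` U) (K `\` V).
have ch : continuous h by exact: Urysohn_continuous.
have h01 x : (0 <= h x <= 1)%R.
  have := @Urysohn_range T R (~` U) (K `\` V) (h x).
  by rewrite /= in_itv/=; apply; exists x.
have h0 x : ~ U x -> h x = 0%R.
  by move=> nU; apply: (Urysohn_sub0 sep); exists x.
have h1 x : K x -> ~ V x -> h x = 1%R.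
  by move=> Kx nV; apply: (Urysohn_sub1 sep); exists x.
have cfe := @cutoff_continuous e _ cf.
have fe01 x : (0 <= cutoff e f x <= 1)%R.
  have /andP[f0 f1] := f01 x; rewrite cutoff_ge0 (le_trans _ f1)//.
  by rewrite cutoff_le// ltW.
have Uh : subordinate U (fun x => cutoff e f x * h x)%R.
  split=> [|x|x nU]; first by move=> x; apply: cvgM; [exact: cfe|exact: ch].
    have /andP[? ?] := fe01 x; have /andP[? ?] := h01 x.
    by rewrite mulr_ge0//= mulr_ile1.
  by rewrite h0// mulr0.
have Vh : subordinate V (fun x => cutoff e f x - cutoff e f x * h x)%R.
  split=> [|x|x nV].
  - move=> x; apply: cvgB; first exact: cfe.
    by apply: cvgM; [exact: cfe|exact: ch].
  - have /andP[? ?] := fe01 x; have /andP[? ?] := h01 x.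
    rewrite -{1 3}(mulr1 (cutoff e f x)) -mulrBr mulr_ge0 ?subr_ge0//=.
    by rewrite mulr_ile1 ?subr_ge0// gerBl.
  - have [Kx|nK] := pselect (K x); first by rewrite h1// mulr1 subrr.
    rewrite cutoff_eq0 ?mul0r ?subrr//.
    by apply/ltW; rewrite ltNge; apply/negP.
apply: (@le_trans _ _ ((L (cutoff e f))%:E + e%:E)).
  by rewrite -EFinD lee_fin mean_cutoff.
rewrite leeD2r//.
have -> : L (cutoff e f) = (L (fun x => cutoff e f x * h x) +
    L (fun x => cutoff e f x - cutoff e f x * h x))%R.
  case: Uh => ? _ _; case: Vh => ? _ _.
  rewrite -(meanD mL)//; congr L; apply/funext => x; by rewrite addrC subrK.
by rewrite EFinD leeD// inner_mass_ubound.
Qed.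

(** Compactness of {e <= f} reduces countable subadditivity to the finite
    case. *)
Lemma inner_mass_bigcup (U : (set T)^nat) : (forall n, open (U n)) ->
  inner_mass (\bigcup_n U n) <= \sum_(n <oo) inner_mass (U n).
Proof.
move=> oU.
have fin n : inner_mass (\bigcup_(i < n) U i) <= \sum_(0 <= i < n) inner_mass (U i).
  elim: n => [|n IH].
    by rewrite big_nil bigcup_mkord big_ord0 inner_mass0.
  rewrite bigcup_mkord big_ord_recr -bigcup_mkord/= big_nat_recr//=.
  apply: le_trans (leeD IH (lexx _)); apply: inner_massU => //.
  by apply: bigcup_open => i _.
apply: ge_ereal_sup => _ [f [cf f01 fU] <-].
apply/lee_addgt0Pr => e e0.
have cK : compact [set x | (e <= f x)%R].
  by apply: (subclosed_compact _ cT) => //; exact: closed_superlevel.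
move: cK; rewrite compact_cover => /(_ nat setT U).
case=> [i _//|x /= ex|D _ KD].
  by apply: contrapT => nx; move: ex; rewrite fU// leNgt e0.
pose n := (\max_(i <- finmap.enum_fset D) i).+1.
have Un : subordinate (\bigcup_(i < n) U i) (cutoff e f).
  have [//|? ? _] := @subordinate_cutoff setT e f (ltW e0).
    by split=> // x [].
  split=> // x nx; apply: cutoff_eq0; rewrite leNgt; apply/negP => ex; apply: nx.
  have [i iD Ux] := KD _ (ltW ex); exists i => //=.
  by rewrite /n ltnS; exact: leq_bigmax_seq.
apply: (@le_trans _ _ ((L (cutoff e f))%:E + e%:E)).
  by rewrite -EFinD lee_fin mean_cutoff.
rewrite leeD2r// (le_trans (inner_mass_ubound Un))// (le_trans (fin n))//.
by apply: nneseries_lim_ge => k _ _; exact: inner_mass_ge0.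
Qed.

Definition outer_mass (A : set T) : \bar R :=
  ereal_inf [set inner_mass U | U in [set U | open U /\ A `<=` U]].

Lemma outer_mass_open U : open U -> outer_mass U = inner_mass U.
Proof.
move=> oU; apply/eqP; rewrite eq_le; apply/andP; split.
  by apply: ereal_inf_lbound; exists U => //; split.
by apply: le_ereal_inf_tmp => _ [V [oV UV] <-]; exact: le_inner_mass.
Qed.

Lemma outer_mass_lbound A U : open U -> A `<=` U -> outer_mass A <= inner_mass U.
Proof. by move=> oU AU; apply: ereal_inf_lbound; exists U. Qed.

Lemma outer_mass_ge0 A : 0 <= outer_mass A.
Proof. by apply: le_ereal_inf_tmp => _ [V [oV UV] <-]; exact: inner_mass_ge0. Qed.

Lemma outer_mass_fin A : outer_mass A \is a fin_num.
Proof.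
rewrite ge0_fin_numE; last exact: outer_mass_ge0.
apply: (@le_lt_trans _ _ 1); last by rewrite ltry.
by rewrite -inner_massT; apply: outer_mass_lbound => //; exact: openT.
Qed.

Lemma outer_mass0 : outer_mass set0 = 0.
Proof. by rewrite outer_mass_open ?inner_mass0//; exact: open0. Qed.

Lemma le_outer_mass : {homo outer_mass : A B / A `<=` B >-> A <= B}.
Proof.
move=> A B AB; apply: le_ereal_inf_tmp => _ [V [oV BV] <-].
by apply: outer_mass_lbound => //; exact: subset_trans BV.
Qed.

Lemma outer_mass_approx A (e : R) : (0 < e)%R ->
  exists U, [/\ open U, A `<=` U & inner_mass U <= outer_mass A + e%:E].
Proof.
move=> e0; have [_ [U [oU AU] <-] ?] := lb_ereal_inf_adherent e0 (outer_mass_fin A).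
by exists U; split=> //; exact: ltW.
Qed.

Lemma outer_mass_sigma_subadditive : sigma_subadditive outer_mass.
Proof.
move=> A; apply/lee_addgt0Pr => e e0.
have e2 n : (0 < e / (2 ^ n.+1)%:R)%R.
  by rewrite divr_gt0// ltr0n expn_gt0.
have /choice[U HU] : forall n, exists U, [/\ open U, A n `<=` U &
    inner_mass U <= outer_mass (A n) + (e / (2 ^ n.+1)%:R)%:E].
  by move=> n; exact: outer_mass_approx.
apply: (@le_trans _ _ (inner_mass (\bigcup_n U n))).
  apply: outer_mass_lbound; first by apply: bigcup_open => n _; case: (HU n).
by apply: subset_bigcup => n _; case: (HU n).
have oU n : open (U n) by case: (HU n).
apply: (le_trans (inner_mass_bigcup oU)).
apply: le_trans (epsilon_trick xpredT _ (ltW e0)); last first.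
  by move=> n; exact: outer_mass_ge0.
apply: lee_nneseries => n; first by move=> *; exact: inner_mass_ge0.
by move=> *; case: (HU n).
Qed.

HB.instance Definition _ := isOuterMeasure.Build R T outer_mass
  outer_mass0 outer_mass_ge0 le_outer_mass outer_mass_sigma_subadditive.

(** Let V be an open neighbourhood of A.  An almost optimal f for the trace of
    U on V, once cut off, can be added to any function carried by the open set
    W = V minus {e/2 <= f}, and the sum is still carried by V.  Since f vanishes
    off U, the set W contains the part of A outside U. *)
Lemma open_caratheodory U : open U -> outer_mass.-caratheodory U.
Proof.
move=> oU; apply: le_caratheodory_measurable => A.
apply: le_ereal_inf_tmp => _ [V [oV AV] <-].
apply/lee_addgt0Pr => e e0; have e20 : (0 < e / 2)%R by rewrite divr_gt0.
have oUV : open (V `&` U) by exact: openI.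
have [_ [f fUV <-] Lf] := ub_ereal_sup_adherent e20 (inner_mass_fin (V `&` U)).
have [cf f01 fUV0] := fUV.
pose W := V `&` ~` [set x | (e / 2 <= f x)%R].
have oW : open W.
  by apply: openI => //; apply: closed_openC; exact: closed_superlevel.
have AW : A `&` ~` U `<=` W.
  move=> x [Ax nUx]; split; first exact: AV.
  by rewrite /= fUV0 ?leNgt ?e20// => -[_].
have key : inner_mass W + (L (cutoff (e / 2) f))%:E <= inner_mass V.
  rewrite -leeBrDr//; apply: ge_ereal_sup => _ [g [cg g01 gW] <-].
  rewrite leeBrDr// -EFinD -(meanD mL)//; last exact: cutoff_continuous.
  apply: inner_mass_ubound; split.
  - by move=> x; apply: cvgD; [exact: cg|exact: cutoff_continuous].
  - move=> x; have /andP[g0 g1] := g01 x; have /andP[f0 f1] := f01 x.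
    rewrite addr_ge0 ?cutoff_ge0//=.
    have [fx|fx] := leP (e / 2)%R (f x).
      by rewrite gW ?add0r ?(le_trans _ f1)// ?cutoff_le// ?ltW// => -[].
    by rewrite cutoff_eq0 ?addr0// ltW.
  - move=> x nV; rewrite gW; last by case.
    by rewrite add0r cutoff_eq0// fUV0 ?ltW// => -[].
apply: (@le_trans _ _ ((L f)%:E + (e / 2)%:E + inner_mass W)).
  apply: leeD; last exact: outer_mass_lbound.
  apply: (@le_trans _ _ (inner_mass (V `&` U))).
    by apply: outer_mass_lbound => //; exact: setSI.
  by rewrite -leeBlDr// ltW.
rewrite [in leRHS](splitr e) EFinD addeA [leLHS]addeAC; apply: leeD2r.
apply: le_trans (leeD key (lexx (e / 2)%:E)).
by rewrite addeC -addeA leeD2l// -EFinD lee_fin mean_cutoff.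
Qed.

Local Notation borel := (g_sigma_algebraType (@open T)).

Lemma borel_caratheodory (A : set borel) : measurable A ->
  outer_mass.-caratheodory A.
Proof.
suff : @measurable _ borel `<=` outer_mass.-caratheodory by exact.
apply: smallest_sub; last by move=> U oU; exact: open_caratheodory.
split.
- exact: caratheodory_measurable_set0.
- by move=> B cB; rewrite setTD; exact: caratheodory_measurable_setC.
- by move=> F cF; exact: caratheodory_measurable_bigcup.
Qed.

Definition borel_mass : set borel -> \bar R := outer_mass.

Lemma borel_mass_semi_sigma_additive : semi_sigma_additive borel_mass.
Proof.
move=> F mF tF mUF.
apply: (@caratheodory_measure_sigma_additive _ _ outer_mass) => //.
  by move=> n; exact: borel_caratheodory.
exact: borel_caratheodory.
Qed.

HB.instance Definition _ := isMeasure.Build _ borel R borel_mass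
  outer_mass0 outer_mass_ge0 borel_mass_semi_sigma_additive.

Lemma borel_massT : borel_mass setT = 1.
Proof. by rewrite /borel_mass outer_mass_open ?inner_massT//; exact: openT. Qed.

HB.instance Definition _ := Measure_isProbability.Build _ borel R borel_mass
  borel_massT.

Lemma inner_mass_probability : exists P : probability borel R,
  forall U : set T, open U -> P U = inner_mass U.
Proof. by exists borel_mass; exact: outer_mass_open. Qed.

End RieszMarkov.

(** * The Riesz-Markov representation theorem *)

Lemma continuous_bounded (R : realType) (T : topologicalType) (f : T -> R) :
  compact [set: T] -> continuous f -> exists2 M, 0 < M & forall x, `|f x| <= M.
Proof.
move=> cT cf.
have /compact_bounded : compact [set f x | x in setT].
  by apply: continuous_compact => //; exact: continuous_subspaceT.
move=> [M0 [_ HM]]; exists (`|M0| + 1); first by rewrite ltr_wpDl.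
move=> x; have := HM (`|M0| + 1) _ (f x) (ex_intro2 _ _ x I erefl); apply.
by rewrite (le_lt_trans (ler_norm M0))// ltrDl.
Qed.

Lemma continuous_borel_measurable (R : realType) (T : ptopologicalType)
    (f : T -> R) : continuous f ->
  measurable_fun [set: g_sigma_algebraType (@open T)] f.
Proof.
move=> cf; apply: (measurability _ (RGenOInfty.measurableE R)) => //.
move=> _ [_ [x ->] <-]; rewrite setTI; apply: sub_sigma_algebra.
by apply: open_comp => //; exact: open_gt.
Qed.

Definition clamp (R : realType) (y : R) : R := Num.min 1 (Num.max 0 y).

(** The layers [clamp (y - k)], k < n, decompose y in [0, n]; each of them lies
    between the indicators of {k + 1 <= y} and {k < y}. *)
Lemma sum_clamp (R : realType) (y : R) n : 0 <= y ->
  \sum_(k < n) clamp (y - k%:R) = Num.min n%:R y.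
Proof.
move=> y0; elim: n => [|n IH]; first by rewrite big_ord0 min_l.
rewrite big_ord_recr/= IH /clamp -natr1 !minEle maxEle.
case: ifP; case: ifP; case: ifP; case: ifP; lra.
Qed.

Lemma sum_indic_ge (R : realType) (y : R) n : 0 <= y ->
  \sum_(k < n) (k%:R < y)%R%:R <= y + 1.
Proof.
move=> y0; suff : \sum_(k < n) (k%:R < y)%R%:R <= Num.min n%:R (y + 1).
  by rewrite le_min => /andP[].
elim: n => [|n IH]; first by rewrite big_ord0 le_min lexx addr_ge0.
rewrite big_ord_recr/=; move: IH; rewrite !le_min -natr1 => /andP[IH1 IH2].
case: ltP => /= ?; apply/andP; split; lra.
Qed.

Section RieszMarkov_integral.
Context {R : realType} {T : ptopologicalType}.
Hypothesis cT : compact [set: T].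
Local Notation borel := (g_sigma_algebraType (@open T)).

Lemma continuous_integrable (P : probability borel R) (f : T -> R) :
  continuous f -> P.-integrable [set: borel] (EFin \o f).
Proof.
move=> cf; apply: measurable_bounded_integrable => //.
- rewrite [X in (X < _)%E]probability_setT ltry//.
- exact: continuous_borel_measurable.
- have [M M0 fM] := continuous_bounded cT cf.
  exists M; split; first exact: num_real.
  by move=> r Mr x _; exact: le_trans (fM x) (ltW Mr).
Qed.

Lemma mean_Rintegral (P : probability borel R) :
  mean (fun f : T -> R => (\int[P]_x f x)%R).
Proof.
split.
- by move=> f g cf cg; rewrite RintegralD//; exact: continuous_integrable.
- by move=> c f cf; rewrite RintegralZl//; exact: continuous_integrable.
- by move=> f cf f0; apply: Rintegral_ge0.
- by rewrite /Rintegral integral_cst//= mul1e probability_setT.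
Qed.

Variables (L : (T -> R) -> R) (P : probability borel R).
Hypothesis mL : mean L.
Hypothesis PE : forall U : set T, open U -> P U = inner_mass L U.

Lemma mean_sum (f : nat -> T -> R) n : (forall k, continuous (f k)) ->
  continuous (fun x => \sum_(k < n) f k x) /\
  L (fun x => \sum_(k < n) f k x) = \sum_(k < n) L (f k).
Proof.
move=> cf; elim: n => [|n [IHc IH]].
  rewrite big_ord0 (_ : (fun x => _) = fun=> 0); last first.
    by apply/funext => x; rewrite big_ord0.
  by split; [exact: cst_continuous|rewrite mean_cst].
rewrite big_ord_recr/= -IH -(meanD mL)//.
rewrite (_ : (fun x => _) = fun x => (\sum_(k < n) f k x) + f n x); last first.
  by apply/funext => x; rewrite big_ord_recr.
by split=> // x; apply: cvgD; [exact: IHc|exact: cf].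
Qed.

(** The k-th layer of n f is carried by the open set {k < n f}, so n L(f) is at
    most the sum of the masses of these sets, which is the integral of the
    number of k < n with k < n f.  That number exceeds n f by at most 1; divide
    by n and let n grow. *)
Lemma mean_le_Rintegral (f : T -> R) : continuous f ->
  (forall x, 0 <= f x <= 1) -> L f <= \int[P]_x f x.
Proof.
move=> cf f01.
suff key n : (n%:R * L f <= n%:R * (\int[P]_x f x) + 1)%R.
  rewrite leNgt; apply/negP; rewrite -subr_gt0 => lt.
  pose n := Num.bound ((L f - \int[P]_x f x)^-1).
  have nlt : (L f - \int[P]_x f x)^-1 < n%:R.
    by apply: archi_boundP; rewrite invr_ge0 ltW.
  have : 1 < n%:R * (L f - \int[P]_x f x) by rewrite -ltr_pdivrMr// div1r.
  by rewrite mulrBr ltrBrDl ltNge key.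
pose h k x := clamp (n%:R * f x - k%:R).
have cnf : continuous (fun x => n%:R * f x).
  by move=> x; apply: cvgM; [exact: cvg_cst|exact: cf].
have ch k : continuous (h k).
  move=> x; apply: (@continuous_min _ _ (fun=> 1) (fun x => _)).
    exact: cvg_cst.
  apply: (@continuous_max _ _ (fun=> 0) (fun x => n%:R * f x - k%:R)).
    exact: cvg_cst.
  by apply: cvgB; [exact: cnf|exact: cvg_cst].
pose U k := [set x | k%:R < n%:R * f x].
have oU k : open (U k).
  by apply: (@open_comp _ _ (fun x => n%:R * f x) [set y | k%:R < y]).
have hU k : subordinate (U k) (h k).
  split=> // x.
    by rewrite /h /clamp ge_min lexx le_min ler01 le_max lexx.
  move=> /negP; rewrite -leNgt => le.
  by rewrite /h /clamp max_l ?subr_le0// min_r// ler01.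
have -> : n%:R * L f = \sum_(k < n) L (h k).
  rewrite -(meanZ mL)// -(mean_sum n ch).2; congr L; apply/funext => x.
  have /andP[f0 f1] := f01 x.
  by rewrite sum_clamp ?mulr_ge0// min_r// ler_piMr.
rewrite -lee_fin -sumEFin.
apply: (@le_trans _ _ (\sum_(k < n) P (U k)))%E.
  by apply: lee_sum => k _; rewrite PE//; exact: inner_mass_ubound.
have mU k : measurable (U k : set borel) by exact: sub_sigma_algebra.
have -> : (\sum_(k < n) P (U k) = \int[P]_x (\sum_(k < n) (\1_(U k) x)%:E))%E.
  rewrite ge0_integral_sum//.
  - by apply: eq_bigr => k _; rewrite integral_indic// setIT.
  - by move=> k; apply/measurable_EFinP; exact: measurable_indic.
have mf : measurable_fun [set: borel] f by exact: continuous_borel_measurable.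
apply: (@le_trans _ _ (\int[P]_x (n%:R * f x + 1)%:E)%E).
  apply: ge0_le_integral => //.
  - by move=> x _; rewrite sume_ge0.
  - apply: emeasurable_sum => k; apply/measurable_EFinP; exact: measurable_indic.
  - apply/measurable_EFinP; apply: measurable_funD => //.
    by apply: measurable_funM.
  - move=> x _; have /andP[f0 f1] := f01 x.
    rewrite sumEFin lee_fin; have := @sum_indic_ge R (n%:R * f x) n.
    move=> /(_ (mulr_ge0 (ler0n _ _) f0)); apply: le_trans.
    apply: ler_sum => k _; rewrite indicE; case: ltP => h'; rewrite /= ler_nat.
      exact: leq_b1.
    by case: (boolP (x \in U k)) => //; rewrite inE /U /= ltNge h'.
have cnf1 : continuous (fun x => n%:R * f x + 1).
  by move=> x; apply: cvgD; [exact: cnf|exact: cvg_cst].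
have mP := mean_Rintegral P.
rewrite -[leLHS]fineK; last first.
  by apply: integrable_fin_num => //; exact: continuous_integrable.
rewrite lee_fin -[leLHS]/(\int[P]_x (n%:R * f x + 1)).
by rewrite (meanD mP)//; [rewrite (meanZ mP)// (mean1 mP)|exact: cst_continuous].
Qed.

(** An affine rescaling extends the inequality to every continuous function,
    and its application to the opposite function gives the converse. *)
Lemma mean_Rintegral_eq (f : T -> R) : continuous f -> L f = \int[P]_x f x.
Proof.
have mP := mean_Rintegral P.
suff le g : continuous g -> L g <= \int[P]_x g x.
  move=> cf; apply/eqP; rewrite eq_le le//= -lerN2.
  have cNf : continuous (fun x => -1 * f x).
    by move=> x; apply: cvgM; [exact: cvg_cst|exact: cf].
  by have := le _ cNf; rewrite (meanZ mL)// (meanZ mP)// !mulN1r.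
move=> cg; have [M M0 gM] := continuous_bounded cT cg.
pose h x := (2 * M)^-1 * (g x + M).
have cgM : continuous (fun x => g x + M).
  by move=> x; apply: cvgD; [exact: cg|exact: cvg_cst].
have ch : continuous h by move=> x; apply: cvgM; [exact: cvg_cst|exact: cgM].
have h01 x : 0 <= h x <= 1.
  have := gM x; rewrite ler_norml => /andP[g1 g2].
  rewrite /h mulr_ge0 ?invr_ge0/=; [|lra|lra].
  by rewrite mulrC ler_pdivrMr; lra.
have := mean_le_Rintegral ch h01.
rewrite /h (meanZ mL)// (meanZ mP)// (meanD mL)//; last exact: cst_continuous.
rewrite (meanD mP)//; last exact: cst_continuous.
rewrite (mean_cst mL) (mean_cst mP) ler_pM2l; first by rewrite lerD2r.
by rewrite invr_gt0 mulr_gt0.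
Qed.

End RieszMarkov_integral.

Theorem riesz_markov (R : realType) (T : ptopologicalType)
    (L : (T -> R) -> R) : hausdorff_space T -> compact [set: T] -> mean L ->
  exists P : probability (g_sigma_algebraType (@open T)) R,
    forall f : T -> R, continuous f -> (\int[P]_x f x)%R = L f.
Proof.
move=> hT cT mL; have [P PE] := inner_mass_probability mL hT cT.
by exists P => f cf; rewrite (mean_Rintegral_eq cT mL PE).
Qed.

(** * Topology of the torus *)

Local Open Scope quotient_scope.

(** The function sin^2(pi z) has period 1 and vanishes only at the integers,
    which lets it separate distinct points of the torus. *)
Lemma sin_pi_int (R : realType) (z k : R) : k \is a Num.int ->
  sin (pi * (z + k)) ^+ 2 = sin (pi * z) ^+ 2.
Proof.
have step n (y : R) : sin (pi * (y + n%:R)) ^+ 2 = sin (pi * y) ^+ 2.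
  elim: n y => [|n IH] y; first by rewrite addr0.
  by rewrite -natr1 addrA mulrDr mulr1 sinDpi sqrrN IH.
move=> /intrP[[n|n] ->]; first by rewrite -pmulrn step.
by rewrite NegzE mulrNz -[LHS](step n.+1) -pmulrn subrK.
Qed.

Lemma sin_pi_eq0 (R : realType) (z : R) : sin (pi * z) = 0 -> z \is a Num.int.
Proof.
pose r := z - (Num.floor z)%:~R => sz0.
have /andP[fz zf] := floor_itv z.
have r0 : 0 <= r by rewrite subr_ge0.
have r1 : r < 1 by rewrite ltrBlDl -intrD1.
have : sin (pi * r) ^+ 2 = 0.
  by rewrite sin_pi_int ?sz0 ?expr0n// rpredN intr_int.
move/eqP; rewrite sqrf_eq0 => /eqP sr0.
have [r_gt0|] := ltP 0 r; last first.
  move=> r_le0; have /eqP : r = 0 by apply/eqP; rewrite eq_le r_le0.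
  by rewrite subr_eq0 => /eqP ->; exact: intr_int.
have : 0 < sin (pi * r).
  by apply: sin_gt0_pi; rewrite mulr_gt0 ?pi_gt0//= gtr_pMr ?pi_gt0.
by rewrite sr0 ltxx.
Qed.

Section torus_topology.
Context {R : realType} {d : nat}.
Implicit Types (f : 'rV[R]_d -> R).

Lemma eq_pi_torus (x y : 'rV[R]_d) :
  x - y \in lattice -> \pi_(torus R d) x = \pi_(torus R d) y.
Proof.
have := Quotient.idealrBE (lattice_zmod (R:=R) (d:=d)) x y.
by move=> -> /eqP.
Qed.

Lemma on_torus_pi f : periodic_Zd f ->
  (on_torus f : torus R d -> R) \o \pi_(torus R d) = f.
Proof. by move=> pf; apply/funext => x; exact: on_torusE. Qed.

Lemma on_torus_continuous f : continuous f -> periodic_Zd f ->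
  continuous (on_torus f : torus R d -> R).
Proof. by move=> cf pf; apply/quotient_continuous; rewrite on_torus_pi. Qed.

Lemma torus_compact : compact [set: torus R d].
Proof.
have -> : [set: torus R d] = [set \pi_(torus R d) x | x in
    [set v : 'rV[R]_d | forall i, `[0, 1]%classic (v ord0 i)]].
  apply/seteqP; split=> // y _.
  pose x : 'rV[R]_d := repr y.
  exists (\row_i (x 0 i - (Num.floor (x 0 i))%:~R)).
    move=> i; rewrite /= mxE in_itv/=; have /andP[fz zf] := floor_itv (x 0 i).
    by rewrite subr_ge0 fz/= lerBlDl -intrD1 ltW.
  rewrite -[RHS]reprK; apply: eq_pi_torus; apply/forallP => i.
  by rewrite !mxE addrAC subrr add0r rpredN intr_int.
apply: continuous_compact.
  by apply: continuous_subspaceT; exact: pi_continuous.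
by apply: (@rV_compact R d (fun=> `[0, 1]%classic)) => i; exact: segment_compact.
Qed.

Lemma torus_separated (y z : torus R d) : y != z ->
  exists2 phi : torus R d -> R, continuous phi & phi y != phi z.
Proof.
move=> yz; pose u : 'rV[R]_d := repr y; pose v : 'rV[R]_d := repr z.
have /forallPn[i ni] : ~~ [forall i, (u - v) 0 i \is a Num.int].
  apply: contra yz => uv; rewrite -[y]reprK -[z]reprK.
  by apply/eqP; exact: eq_pi_torus.
pose f (w : 'rV[R]_d) : R := sin (pi * (w 0 i - v 0 i)) ^+ 2.
have cf : continuous f.
  move=> w; apply: (@continuous_comp _ _ _ _ (fun x : R => x ^+ 2)); last first.
    exact: exprn_continuous.
  apply: (@continuous_comp _ _ _
    (fun w : 'rV[R]_d => pi * (w 0 i - v 0 i)) (@sin R)); last first.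
    exact: continuous_sin.
  apply: (@continuousM _ _ (fun=> pi) (fun w : 'rV[R]_d => w 0 i - v 0 i)).
    exact: cst_continuous.
  apply: (@continuousB _ _ _ (fun w : 'rV[R]_d => w 0 i) (fun=> v 0 i)).
    exact: coord_continuous.
  exact: cst_continuous.
have pf : periodic_Zd f.
  by move=> x k /forallP kZ; rewrite /f mxE addrAC (sin_pi_int _ (kZ i)).
exists (on_torus f : torus R d -> R); first exact: on_torus_continuous.
rewrite /on_torus/= /f -/u -/v subrr mulr0 sin0 expr0n/= sqrf_eq0.
by apply: contra ni => /eqP/sin_pi_eq0; rewrite !mxE.
Qed.

Lemma torus_hausdorff : hausdorff_space (torus R d).
Proof.
move=> y z yz; apply/eqP; apply: contrapT => /negP/torus_separated[phi cphi].
apply/negP/negPn/eqP; apply: (@norm_hausdorff _ R) => A B Ay Bz.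
have [w [Aw Bw]] := yz _ _ (cphi y _ Ay) (cphi z _ Bz).
by exists (phi w).
Qed.

Lemma periodic_bounded f : continuous f -> periodic_Zd f ->
  exists2 M, 0 < M & forall x, `|f x| <= M.
Proof.
move=> cf pf.
have [M M0 HM] := continuous_bounded torus_compact (on_torus_continuous cf pf).
by exists M => // x; rewrite -(on_torusE x pf).
Qed.

Lemma torus_mean_measure (L : (torus R d -> R) -> R) : mean L ->
  exists mu : probability (borel_torus R d) R,
    forall f, continuous f -> periodic_Zd f ->
      torus_integral mu f = L (on_torus f).
Proof.
move=> mL; have [P PE] := riesz_markov torus_hausdorff torus_compact mL.
by exists P => f cf pf; rewrite -PE//; exact: on_torus_continuous.
Qed.

End torus_topology.

Local Close Scope quotient_scope.

(** * Mean value inequalities and Gronwall's lemma *)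

Section real_calculus.
Context {R : realType}.
Implicit Types (h dh E dE : R -> R) (s t M K : R).

Lemma is_derive_continuous h dh t : is_derive t 1 h (dh t) -> {for t, continuous h}.
Proof. by move=> dht; apply/differentiable_continuous/derivable1_diffP. Qed.

(** A half-line is the natural domain here: a primitive defined by integration
    from a is differentiable only to the right of a. *)
Lemma mean_value_le h dh M a : (forall t, a < t -> is_derive t 1 h (dh t)) ->
  (forall t, a < t -> `|dh t| <= M) ->
  forall s t, a < s -> a < t -> `|h t - h s| <= M * `|t - s|.
Proof.
move=> dH hM s t; wlog st : s t / s < t => [wh as_ at_|as_ at_].
  have [st|ts|->] := ltgtP s t; first exact: wh.
    by rewrite distrC (distrC t); exact: wh.
  by rewrite !subrr !normr0 mulr0.
have [x||c + ->] := @MVT R h dh s t st.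
- by rewrite in_itv/= => /andP[sx _]; apply: dH; exact: lt_trans sx.
- apply: continuous_in_subspaceT => x; rewrite inE/= in_itv/= => /andP[sx _].
  by apply: (@is_derive_continuous h dh); apply: dH; exact: lt_le_trans sx.
rewrite in_itv/= => /andP[sc _]; rewrite normrM ler_wpM2r//.
by apply: hM; exact: lt_trans sc.
Qed.

Lemma mean_value_le_line h dh M : (forall t, is_derive t 1 h (dh t)) ->
  (forall t, `|dh t| <= M) -> forall s t, `|h t - h s| <= M * `|t - s|.
Proof.
move=> dH hM s t.
apply: (@mean_value_le h dh M (Num.min s t - 1)) => //.
  by rewrite ltrBlDr gt_min ltrDl ltr01.
by rewrite ltrBlDr gt_min !ltrDl ltr01 orbT.
Qed.

Lemma nonincreasing_of_derive h dh : (forall t, is_derive t 1 h (dh t)) ->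
  (forall t, dh t <= 0) -> forall s t, s <= t -> h t <= h s.
Proof.
move=> dH h0 s t st.
have ch : {within `[s, t], continuous h}.
  by apply: continuous_subspaceT => x; exact: (@is_derive_continuous h dh).
have [c _ E] := MVT_segment st (fun x _ => dH x) ch.
by rewrite -subr_le0 E mulr_le0_ge0// subr_ge0.
Qed.

Lemma is_derive_translate (V : normedModType R) (u : R -> V) s t (v : V) :
  is_derive (s + t) 1 u v -> is_derive s 1 (fun r => u (r + t)) v.
Proof.
move=> du.
have E : (fun h : R =>
         h^-1 *: (((fun r => u (r + t)) \o shift s) (h *: 1) - u (s + t)))
       = (fun h : R => h^-1 *: ((u \o shift (s + t)) (h *: 1) - u (s + t))).
  by apply/funext => h; congr (_ *: (u _ - _)); rewrite /= addrA.
apply: DeriveDef; first by rewrite /derivable E; exact: ex_derive.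
by rewrite /derive E; exact: derive_val.
Qed.

Lemma is_derive_expR_scale (K t : R) :
  is_derive t 1 (fun x => expR (K * x)) (K * expR (K * t)).
Proof.
have d1 : is_derive t 1 (fun x : R => K * x) K.
  have -> : (fun x : R => K * x) = K \*: (id : R -> R) by [].
  by apply: is_derive_eq; rewrite [LHS]mulr1.
have := @is_derive1_comp R (@expR R) (fun x => K * x) t _ _ (is_derive_expR _) d1.
by rewrite mulrC.
Qed.

(** The hypothesis says that exp(-K t) E(t) is nonincreasing. *)
Lemma gronwall_one_sided E dE K : (forall t, is_derive t 1 E (dE t)) ->
  (forall t, dE t <= K * E t) ->
  forall s t, s <= t -> E t <= expR (K * (t - s)) * E s.
Proof.
move=> dEt EK s t st.
pose h (t : R) := expR (- K * t) * E t.
pose dh (t : R) := expR (- K * t) * (dE t - K * E t).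
have dH (x : R) : is_derive x 1 h (dh x).
  have e := is_derive_expR_scale (- K) x.
  have -> : h = (fun x => expR (- K * x)) * E by [].
  apply: is_derive_eq; rewrite /dh /GRing.scale/=.
  by rewrite mulrBr; congr (_ + _); ring.
have h0 (x : R) : dh x <= 0.
  by rewrite /dh pmulr_rle0 ?expR_gt0// subr_le0.
have := nonincreasing_of_derive dH h0 st; rewrite /h => ht.
have : expR (K * t) * (expR (- K * t) * E t) <=
       expR (K * t) * (expR (- K * s) * E s) by rewrite ler_pM2l ?expR_gt0.
rewrite !mulrA -!expRD mulNr subrr expR0 mul1r.
by have -> : K * t + - K * s = K * (t - s) by ring.
Qed.

Lemma is_derive_reflect h t (c : R) :
  is_derive (- t) 1 h c -> is_derive t 1 (fun x => h (- x)) (- c).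
Proof.
move=> dH; have dN : is_derive t (1 : R) (-%R : R -> R) (-1) by exact: is_deriveNid.
by have := @is_derive1_comp R h -%R t c (-1) dH dN; rewrite mulrN1.
Qed.

(** Negative times follow by time reversal. *)
Lemma gronwall E dE K : (forall t, is_derive t 1 E (dE t)) ->
  (forall t, `|dE t| <= K * E t) -> forall t, E t <= expR (K * `|t|) * E 0.
Proof.
move=> dEt EK t; have [t0|t0] := leP 0 t.
  have EK' (x : R) : dE x <= K * E x by exact: le_trans (ler_norm _) (EK x).
  by have := gronwall_one_sided dEt EK' t0; rewrite subr0 (ger0_norm t0).
have dN (x : R) : is_derive x 1 (fun y => E (- y)) (- dE (- x)).
  exact: is_derive_reflect.
have NK (x : R) : - dE (- x) <= K * E (- x).
  by apply: le_trans (EK (- x)); rewrite -normrN ler_norm.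
have t0' : 0 <= - t by rewrite oppr_ge0 ltW.
by have := gronwall_one_sided dN NK t0'; rewrite /= subr0 oppr0 opprK (ltr0_norm t0).
Qed.

End real_calculus.

Section row_vectors.
Context {R : realType} {d : nat}.
Implicit Types (x y v : 'rV[R]_d) (f : 'rV[R]_d -> R).

Lemma le_coord_norm x i : `|x 0 i| <= `|x|.
Proof.
rewrite [leRHS]/Num.norm/= mx_normrE.
exact: (@le_bigmax _ _ _ _ (fun ij : 'I_1 * 'I_d => `|x ij.1 ij.2|) (0, i)).
Qed.

Lemma norm_le_coord x (c : R) : 0 <= c -> (forall i, `|x 0 i| <= c) -> `|x| <= c.
Proof.
move=> c0 xc; rewrite [leLHS]/Num.norm/= mx_normrE.
by apply: bigmax_le => // -[j i] _ /=; rewrite (ord1 j); exact: xc.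
Qed.

(** The sup norm of row vectors is not differentiable; the squared Euclidean
    norm is a differentiable substitute, equivalent to it up to a factor d. *)
Definition sqnorm x : R := \sum_i x 0 i ^+ 2.

Lemma sqnorm_ge0 x : 0 <= sqnorm x.
Proof. by apply: sumr_ge0 => i _; exact: sqr_ge0. Qed.

Lemma le_coord_sqnorm x i : x 0 i ^+ 2 <= sqnorm x.
Proof.
rewrite /sqnorm (bigD1 i)//= lerDl.
by apply: sumr_ge0 => j _; exact: sqr_ge0.
Qed.

Lemma norm_le_sqnorm x : `|x| ^+ 2 <= sqnorm x.
Proof.
rewrite -(@sqr_sqrtr _ (sqnorm x)) ?sqnorm_ge0//.
rewrite ler_sqr ?nnegrE ?sqrtr_ge0//.
apply: norm_le_coord => [|i]; first exact: sqrtr_ge0.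
by rewrite -sqrtr_sqr ler_wsqrtr// le_coord_sqnorm.
Qed.

Lemma sqnorm_le_norm x : sqnorm x <= d%:R * `|x| ^+ 2.
Proof.
apply: (@le_trans _ _ (\sum_(i < d) `|x| ^+ 2)).
  apply: ler_sum => i _; rewrite -real_normK ?num_real//.
  by rewrite ler_sqr ?nnegrE// le_coord_norm.
by rewrite sumr_const card_ord mulr_natl.
Qed.

Lemma is_derive_coord (X : R -> 'rV[R]_d) (t : R) v i :
  is_derive t 1 X v -> is_derive t 1 (fun s => X s 0 i) (v 0 i).
Proof.
move=> dX; have DX : derivable X t 1 by [].
apply: DeriveDef; first exact: (derivable_mxP X t 1).1.
by have := derive_mx DX; rewrite derive_val => ->; rewrite mxE.
Qed.

Lemma is_derive_line f x v (s : R) : derivable f (x + s *: v) v ->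
  is_derive s 1 (fun r => f (x + r *: v)) ('D_v f (x + s *: v)).
Proof.
move=> df.
have E : (fun h : R => h^-1 *:
         (((fun r => f (x + r *: v)) \o shift s) (h *: 1) - f (x + s *: v)))
       = (fun h : R => h^-1 *: ((f \o shift (x + s *: v)) (h *: v) - f (x + s *: v))).
  apply/funext => h; congr (_ *: (f _ - _)).
  by rewrite /= [h *: 1]mulr1 scalerDl addrCA.
apply: DeriveDef; first by rewrite /derivable E.
by rewrite /derive E.
Qed.

Lemma partial_periodic f i : periodic_Zd f -> periodic_Zd (partial i f).
Proof.
move=> pf x k kZ; rewrite /partial /derive.
set v := delta_mx 0 i.
have -> : (fun h : R => h^-1 *: ((f \o shift (x + k)) (h *: v) - f (x + k)))
        = (fun h : R => h^-1 *: ((f \o shift x) (h *: v) - f x)).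
  by apply/funext => h; rewrite /= addrA !(pf _ k kZ).
by [].
Qed.

End row_vectors.

(** * The flow of a periodic vector field of class C^1 *)

Section lipschitz.
Context {R : realType} {d : nat}.
Implicit Types (x y : 'rV[R]_d) (f : 'rV[R]_d -> R).

Definition mix_coords (k : nat) x y : 'rV[R]_d :=
  \row_j (if (j < k)%N then y 0 j else x 0 j).

Lemma mix_coordsS (i : 'I_d) x y :
  mix_coords i.+1 x y = mix_coords i x y + (y 0 i - x 0 i) *: delta_mx 0 i.
Proof.
apply/rowP => j; rewrite !mxE ltnS leq_eqVlt eqxx andTb.
have [->|ij] := eqVneq j i; first by rewrite eqxx ltnn mulr1 addrC subrK.
by rewrite (negbTE (_ : val j != val i)) ?mulr0 ?addr0.
Qed.

(** Move from x to y along the d edges of a path parallel to the axes and apply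
    the one-dimensional mean value inequality on each edge. *)
Lemma lipschitz_of_partials f (M : R) :
  (forall i x, derivable f x (delta_mx 0 i)) ->
  (forall i x, `|partial i f x| <= M) ->
  forall x y, `|f y - f x| <= d%:R * (M * `|y - x|).
Proof.
move=> df fM x y.
suff key k : (k <= d)%N ->
    `|f (mix_coords k x y) - f x| <= k%:R * (M * `|y - x|).
  have -> : y = mix_coords d x y.
    by apply/rowP => j; rewrite mxE ltn_ord.
  have -> : mix_coords d x y - x = y - x.
    by apply/rowP => j; rewrite !mxE ltn_ord.
  exact: key.
elim: k => [_|k IH kd].
  have -> : mix_coords 0 x y = x by apply/rowP => j; rewrite mxE.
  by rewrite subrr normr0 mul0r.
pose i := Ordinal kd; rewrite -[k.+1]/(i.+1) mix_coordsS.
set z := mix_coords i x y.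
rewrite -(subrKA (f z)) (le_trans (ler_normD _ _))// -natr1 mulrDl mul1r addrC.
apply: lerD; first exact: (IH (ltnW kd)).
have dline (s : R) : is_derive s 1 (fun r => f (z + r *: delta_mx 0 i))
    (partial i f (z + s *: delta_mx 0 i)) by exact: is_derive_line.
have := mean_value_le_line dline (fun s => fM i _) 0 (y 0 i - x 0 i).
rewrite scale0r addr0 subr0 => /le_trans; apply.
apply: ler_wpM2l; first exact: le_trans (fM i x).
by have := le_coord_norm (y - x) i; rewrite !mxE.
Qed.

Lemma C1_periodic_lipschitz (b : 'rV[R]_d -> 'rV[R]_d) : Csharp_vec 1 b ->
  exists2 K, 0 <= K &
    forall i x y, `|b y 0 i - b x 0 i| <= K * `|y - x|.
Proof.
move=> bC1.
have dp i j : (forall x, derivable (fun x => b x 0 i) x (delta_mx 0 j)) /\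
    exists2 M, 0 < M & forall x, `|partial j (fun x => b x 0 i) x| <= M.
  have [[_ /(_ j)[db [cp _]]] pb] := bC1 i; split=> //.
  by apply: periodic_bounded => //; exact: partial_periodic.
have /choice[M HM] : forall ij : 'I_d * 'I_d, exists M : R, 0 < M /\
    forall x, `|partial ij.2 (fun x => b x 0 ij.1) x| <= M.
  by move=> [i j]; have [_ [M M0 HM]] := dp i j; exists M.
(* the sum of the finitely many bounds is a common bound *)
pose S := \sum_ij M ij.
have MS ij : M ij <= S.
  rewrite /S (bigD1 ij)//= lerDl; apply: sumr_ge0 => k _.
  by apply: ltW; case: (HM k).
have S0 : 0 <= S by apply: sumr_ge0 => k _; apply: ltW; case: (HM k).
exists (d%:R * S); first by rewrite mulr_ge0.
move=> i x y; rewrite -mulrA.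
apply: (@lipschitz_of_partials (fun x => b x 0 i)) => j z.
  by case: (dp i j).
by apply: le_trans (MS (i, j)); case: (HM (i, j)).
Qed.

End lipschitz.

Section flow.
Context {R : realType} {d : nat}.
Variable b : 'rV[R]_d -> 'rV[R]_d.
Hypothesis b_C1 : Csharp_vec 1 b.
Implicit Types (x y : 'rV[R]_d) (u v : R -> 'rV[R]_d).

(** The constant C is the same for all pairs of solutions: for a fixed time
    this bounds the Lipschitz constant of the flow map. *)
Lemma solutions_close : exists C : R, forall u v,
  (forall t : R, is_derive t 1 u (b (u t))) ->
  (forall t : R, is_derive t 1 v (b (v t))) ->
  forall t : R, `|u t - v t| ^+ 2 <= expR (C * `|t|) * (d%:R * `|u 0 - v 0| ^+ 2).
Proof.
have [K K0 bK] := C1_periodic_lipschitz b_C1.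
exists (d%:R * (2 * K)) => u v du dv t.
pose E (s : R) := sqnorm (u s - v s).
pose dE (s : R) := \sum_(i < d)
  2 * (u s 0 i - v s 0 i) * (b (u s) 0 i - b (v s) 0 i).
have dEP (s : R) : is_derive s 1 E (dE s).
  have -> : E = \sum_(i < d) ((fun r => u r 0 i) - (fun r => v r 0 i)) ^+ 2.
    apply/funext => r; rewrite /E /sqnorm fct_sumE.
    by apply: eq_bigr => i _; rewrite !mxE.
  apply: is_derive_sum => i.
  have dui := is_derive_coord i (du s); have dvi := is_derive_coord i (dv s).
  by apply: is_derive_eq; rewrite /= expr1.
have EK s : `|dE s| <= d%:R * (2 * K) * E s.
  apply: (@le_trans _ _ (\sum_(i < d) 2 * K * E s)); last first.
    by rewrite sumr_const card_ord -[leLHS]mulr_natl mulrA.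
  apply: le_trans (ler_norm_sum _ _ _) _; apply: ler_sum => i _.
  rewrite !normrM ger0_norm// -!mulrA ler_pM2l//.
  apply: (@le_trans _ _ (`|u s - v s| * (K * `|u s - v s|))).
    apply: ler_pM => //.
    by have := le_coord_norm (u s - v s) i; rewrite !mxE.
  by rewrite mulrCA -expr2 ler_wpM2l// norm_le_sqnorm.
apply: (le_trans (norm_le_sqnorm _)); apply: (le_trans (gronwall dEP EK t)).
by rewrite ler_pM2l ?expR_gt0// sqnorm_le_norm.
Qed.

Lemma solution_unique u v :
  (forall t : R, is_derive t 1 u (b (u t))) ->
  (forall t : R, is_derive t 1 v (b (v t))) ->
  u 0 = v 0 -> forall t, u t = v t.
Proof.
move=> du dv uv0 t; have [C HC] := solutions_close.
have := HC u v du dv t; rewrite uv0 subrr normr0 expr0n/= !mulr0.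
rewrite exprn_even_le0//= normr_eq0 subr_eq0.
by move/eqP.
Qed.

Variable X : R -> 'rV[R]_d -> 'rV[R]_d.
Hypothesis X_sol : is_solution b X.

(** Both sides solve the equation in s with the value X(t, x) at s = 0. *)
Lemma flow_semigroup s t x : X (s + t) x = X s (X t x).
Proof.
apply: (@solution_unique (fun r => X (r + t) x) (X ^~ (X t x))).
- by move=> r; apply: (@is_derive_translate _ _ (X ^~ x)); exact: (X_sol x).2.
- by move=> r; exact: (X_sol _).2.
- by rewrite add0r (X_sol _).1.
Qed.

Lemma flow_translate t x (k : 'rV[R]_d) : k \in lattice -> X t (x + k) = X t x + k.
Proof.
move=> kZ; apply: (@solution_unique (X ^~ (x + k)) (fun r => X r x + k)).
- by move=> r; exact: (X_sol _).2.
- move=> r; have dX := (X_sol x).2 r.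
  have -> : (fun q => X q x + k) = (X ^~ x) + (cst k) by [].
  apply: is_derive_eq; rewrite addr0; apply/rowP => i.
  by have [_ pb] := b_C1 i; rewrite /= pb.
- by rewrite !(X_sol _).1.
Qed.

Lemma flow_continuous t : continuous (X t).
Proof.
have [C HC] := solutions_close.
pose c := Num.sqrt (expR (C * `|t|) * d%:R).
have Xc x y : `|X t x - X t y| <= c * `|x - y|.
  have := HC (X ^~ x) (X ^~ y) (X_sol x).2 (X_sol y).2 t.
  rewrite (X_sol x).1 (X_sol y).1 mulrA => le2.
  rewrite -ler_sqr ?nnegrE ?mulr_ge0 ?sqrtr_ge0// exprMn.
  by rewrite sqr_sqrtr// mulr_ge0// expR_ge0.
have c1 : 0 < c + 1 by rewrite ltr_wpDl// sqrtr_ge0.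
move=> x; apply/(@cvgrPdist_le _ _ _ _ (nbhs_filter x)) => e e0.
have near_x : \forall y \near x, `|x - y| <= e / (c + 1).
  have /(@cvgrPdist_le _ _ _ _ (nbhs_filter x)) := @cvg_id _ (nbhs x).
  by apply; rewrite divr_gt0.
apply: filterS near_x => y; rewrite ler_pdivlMr// mulrC => xy.
apply: le_trans (Xc x y) (le_trans _ xy).
by rewrite ler_wpM2r// lerDl.
Qed.

Lemma orbit_continuous x : continuous (X ^~ x).
Proof.
move=> t; apply/differentiable_continuous/derivable1_diffP.
by have dX := (X_sol x).2 t; exact: ex_derive.
Qed.

Lemma flow_Csharp0 t (psi : 'rV[R]_d -> R) : Csharp 0 psi -> Csharp 0 (flow X t psi).
Proof.
move=> [[cpsi _] ppsi]; split; first split=> //.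
  by move=> x; apply: continuous_comp; [exact: flow_continuous|exact: cpsi].
by move=> x k kZ; rewrite /flow flow_translate// ppsi.
Qed.

End flow.

(** * Limits of means and time averages *)

Section mean_constructions.
Context {R : realType}.

Lemma mean_norm_le (T : ptopologicalType) (L : (T -> R) -> R) (f : T -> R) (M : R) :
  mean L -> continuous f -> (forall x, `|f x| <= M) -> `|L f| <= M.
Proof.
move=> mL cf fM; rewrite ler_norml; apply/andP; split.
  rewrite -(mean_cst mL (- M)); apply: le_mean => //; first exact: cst_continuous.
  by move=> x; have := fM x; rewrite ler_norml => /andP[].
rewrite -(mean_cst mL M); apply: le_mean => //; first exact: cst_continuous.
by move=> x; have := fM x; rewrite ler_norml => /andP[].
Qed.

Lemma mean_comp (S T : topologicalType) (L : (S -> R) -> R) (j : S -> T) :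
  mean L -> continuous j -> mean (fun f : T -> R => L (f \o j)).
Proof.
move=> mL cj.
have cfj (f : T -> R) : continuous f -> continuous (f \o j).
  by move=> cf x; apply: continuous_comp; [exact: cj|exact: cf].
split.
- by move=> f g cf cg; rewrite -(meanD mL)//; exact: cfj.
- by move=> c f cf; rewrite -(meanZ mL)//; exact: cfj.
- by move=> f cf f0; apply: (mean_ge0 mL); [exact: cfj|move=> x; exact: f0].
- exact: (mean1 mL).
Qed.

(** Bounded values have a cluster point by compactness, and along an
    ultrafilter a cluster point is a limit. *)
Lemma ultra_bounded_cvg (I : Type) (F : set_system I) (u : I -> R) (M : R) :
  UltraFilter F -> (\forall i \near F, `|u i| <= M) -> cvg (u @ F).
Proof.
move=> UF uM; have PF : ProperFilter F by exact: ultra_proper.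
have [|p [_ clp]] := @segment_compact R (- M) M (u @ F) _.
  by apply: filterS uM => i; rewrite /= in_itv/= ler_norml.
apply/cvg_ex; exists p => /= B Bp.
have [//|FB] := in_ultra_setVsetC (u @^-1` B) UF.
by have [y []] := clp (~` B) B FB Bp.
Qed.

(** The values A_i(f) stay bounded for each continuous f, since means do not
    exceed the bound of f on a compact space; an ultrafilter then chooses a
    limit for all f at once, compatibly with sums and multiples. *)
Lemma mean_ultralimit (T : ptopologicalType) (I : Type) (F : set_system I)
    (A : I -> (T -> R) -> R) :
  compact [set: T] -> UltraFilter F -> (\forall i \near F, mean (A i)) ->
  (forall f : T -> R, continuous f ->
     A i f @[i --> F] --> lim (A i f @[i --> F])) /\
  mean (fun f : T -> R => lim (A i f @[i --> F])).
Proof.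
move=> cT UF mA; have PF : ProperFilter F by exact: ultra_proper.
have cvgA (f : T -> R) : continuous f -> A i f @[i --> F] --> lim (A i f @[i --> F]).
  move=> cf; have [M M0 fM] := continuous_bounded cT cf.
  apply: (@ultra_bounded_cvg _ _ _ M) => //.
  by apply: filterS mA => i mAi; exact: mean_norm_le.
split=> //; split.
- move=> f g cf cg; apply: cvg_lim => //.
  apply: (cvg_trans _ (cvgD (cvgA f cf) (cvgA g cg))).
  by apply: near_eq_cvg; apply: filterS mA => i mAi; rewrite (meanD mAi).
- move=> c f cf; apply: cvg_lim => //.
  apply: (cvg_trans _ (cvgM (cvg_cst c) (cvgA f cf))).
  by apply: near_eq_cvg; apply: filterS mA => i mAi; rewrite (meanZ mAi).
- move=> f cf f0; apply: limr_ge; first exact: cvgA.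
  by apply: filterS mA => i mAi; exact: (mean_ge0 mAi).
- apply: cvg_lim => //; apply: (cvg_trans _ (@cvg_cst _ (1 : R) _ F _)).
  by apply: near_eq_cvg; apply: filterS mA => i mAi; rewrite (mean1 mAi).
Qed.

End mean_constructions.

Section time_average.
Context {R : realType}.
Implicit Types (h : R -> R) (T tau M : R).
Local Notation leb := (@lebesgue_measure R).

Definition time_average T h : R := T^-1 * \int[leb]_(s in `[0, T]) h s.

Lemma continuous_integrable_itv (a b : R) h : continuous h ->
  leb.-integrable `[a, b] (EFin \o h).
Proof.
move=> ch; apply: continuous_compact_integrable; first exact: segment_compact.
exact: continuous_subspaceT.
Qed.

Lemma mean_time_average T : 0 < T -> mean (time_average T).
Proof.
move=> T0; split.
- move=> f g cf cg; rewrite /time_average RintegralD ?mulrDr//;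
    exact: continuous_integrable_itv.
- move=> c f cf; rewrite /time_average [RHS]mulrCA; congr (_ * _).
  by apply: RintegralZl => //; exact: continuous_integrable_itv.
- move=> f cf f0; apply: mulr_ge0; first by rewrite invr_ge0 ltW.
  by apply: Rintegral_ge0.
- have lebT : leb `[0, T] = T%:E.
    by rewrite lebesgue_measure_itv/= lte_fin T0 sube0.
  by rewrite /time_average Rintegral_cst// mul1r [X in fine X]lebT mulVf// gt_eqF.
Qed.

Lemma continuous_primitive (a : R) h : continuous h ->
  exists H : R -> R, forall t : R, a < t -> is_derive t 1 H (h t).
Proof.
move=> ch; exists (fun x => \int[leb]_(s in `[a, x]) h s) => t at_.
have tt1 : t < t + 1 by rewrite ltrDl.
have hint := @continuous_integrable_itv a (t + 1) h ch.
have [dH EH] := continuous_FTC1_closed tt1 hint at_ (ch t).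
by apply: DeriveDef => //; rewrite -derive1E.
Qed.

(** With H a primitive of h, the two integrals differ by
    (H(T + tau) - H(T)) - (H(tau) - H(0)), and each increment is over an
    interval of length |tau|. *)
Lemma time_average_shift T tau M h : 0 < T -> continuous h ->
  (forall s, `|h s| <= M) ->
  `|time_average T (fun s => h (s + tau)) - time_average T h| <=
    T^-1 * (2 * (M * `|tau|)).
Proof.
move=> T0 ch hM; pose a := Num.min 0 tau - 1.
(* a lies strictly to the left of both intervals of integration, so that a
   primitive based at a is differentiable on them, endpoints included *)
have a0 : a < 0 by rewrite ltrBlDr gt_min add0r ltr01.
have atau : a < tau by rewrite ltrBlDr gt_min !ltrDl ltr01 orbT.
have [H dH] := continuous_primitive a ch.
have int_h (c : R) : a < c -> \int[leb]_(s in `[0, T]) h (s + c) = H (T + c) - H c.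
  move=> ac.
  have dHc (s : R) : 0 <= s -> is_derive s 1 (fun r => H (r + c)) (h (s + c)).
    by move=> s0; apply: is_derive_translate; apply: dH; exact: ltr_wpDl.
  have cHc (s : R) : 0 <= s -> {for s, continuous (fun r => H (r + c))}.
    by move=> s0; exact: (@is_derive_continuous _ _ (fun r => h (r + c)) _ (dHc s s0)).
  rewrite /Rintegral (@continuous_FTC2 _ (fun s => h (s + c)) (fun s => H (s + c)))//=.
  - by rewrite add0r.
  - apply: continuous_subspaceT => s; apply: continuous_comp; last exact: ch.
    by apply: cvgD; [exact: cvg_id|exact: cvg_cst].
  - split.
    + by move=> s; rewrite in_itv/= => /andP[s0 _]; have dHs := dHc s (ltW s0).
    + by apply: cvg_at_right_filter; exact: cHc.
    + by apply: cvg_at_left_filter; apply: cHc; exact: ltW.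
  - move=> s; rewrite in_itv/= => /andP[s0 _]; have dHs := dHc s (ltW s0).
    by rewrite derive1E derive_val.
have int0 := int_h 0 a0.
have inttau := int_h tau atau.
rewrite /time_average -mulrBr normrM ger0_norm; last by rewrite invr_ge0 ltW.
rewrite ler_pM2l ?invr_gt0// inttau.
under [X in _ - X]eq_Rintegral do rewrite -[s in h s]addr0.
rewrite int0 addr0.
have -> : H (T + tau) - H tau - (H T - H 0) =
    (H (T + tau) - H T) - (H tau - H 0) by ring.
apply: (le_trans (ler_normB _ _)); rewrite mulr_natl mulr2n; apply: lerD.
  have -> : `|tau| = `|T + tau - T| by rewrite addrAC subrr add0r.
  apply: (mean_value_le dH) => //; first exact: lt_trans T0.
  by rewrite ltr_wpDl// ltW.
rewrite -[X in M * `|X|]subr0.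
exact: (mean_value_le dH).
Qed.

End time_average.

(** * Invariant measures *)

Lemma increasing_seq_cvgy (phi : nat -> nat) : increasing_seq phi ->
  phi n @[n --> \oo] --> \oo.
Proof.
move=> /increasing_seqP phi_lt A [N _ NA]; exists N => // n Nn; apply: NA.
apply: leq_trans Nn _; elim: n => // n IH.
exact: leq_ltn_trans IH (phi_lt n).
Qed.

Section orbit_averages.
Context {R : realType} {d : nat}.
Variables (b : 'rV[R]_d -> 'rV[R]_d) (X : R -> 'rV[R]_d -> 'rV[R]_d).
Hypotheses (b_C1 : Csharp_vec 1 b) (X_sol : is_solution b X).

(** The measure depends on the orbit and on the sequence of times, but not on
    the function g whose averages converge: the same ultrafilter serves all
    continuous functions. *)
Lemma invariant_measure_of_averages (x : 'rV[R]_d) (t : R^nat) :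
  t @ \oo --> +oo ->
  exists mu : probability (borel_torus R d) R,
    invariant_measure X mu /\
    forall (g : 'rV[R]_d -> R) (a : R), Csharp 0 g ->
      time_average (t n) (fun s => g (X s x)) @[n --> \oo] --> a ->
      a = torus_integral mu g.
Proof.
move=> t_oo.
have [F [UF ooF]] := @ultraFilterLemma nat \oo _.
have PF : ProperFilter F by exact: ultra_proper.
pose orbit (s : R) : torus R d := (\pi_(torus R d) (X s x))%qT.
have corbit : continuous orbit.
  move=> s; apply: (@continuous_comp _ _ _ (X ^~ x)).
    exact: (orbit_continuous X_sol).
  exact: pi_continuous.
pose A n (phi : torus R d -> R) := time_average (t n) (phi \o orbit).
have t_gt0 : \forall n \near F, 0 < t n.
  by apply: ooF; move/cvgryPgt: t_oo; apply.
have mA : \forall n \near F, mean (A n).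
  by apply: filterS t_gt0 => n tn; apply: mean_comp corbit; exact: mean_time_average.
have [cvgA mL] := mean_ultralimit (@torus_compact R d) UF mA.
have [mu muE] := torus_mean_measure mL.
have AE n (f : 'rV[R]_d -> R) : periodic_Zd f ->
    A n (on_torus f) = time_average (t n) (fun s => f (X s x)).
  by move=> pf; congr (time_average _ _); apply/funext => s; exact: on_torusE.
have cvg_mu (f : 'rV[R]_d -> R) : Csharp 0 f ->
    time_average (t n) (fun s => f (X s x)) @[n --> F] --> torus_integral mu f.
  move=> [[cf _] pf]; rewrite muE//.
  under eq_fun do rewrite -AE//.
  exact/cvgA/on_torus_continuous.
exists mu; split; last first.
  move=> g a gC ga.
  rewrite -(cvg_lim (@Rhausdorff R) (cvg_mu g gC)); apply/esym/cvg_lim => //.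
  by apply: cvg_trans ga => B /ooF.
move=> tau psi psiC.
have [[cpsi _] ppsi] := psiC.
have [M M0 psiM] := periodic_bounded cpsi ppsi.
pose D n := time_average (t n) (fun s => flow X tau psi (X s x)) -
            time_average (t n) (fun s => psi (X s x)).
have D_cvg : D n @[n --> F] -->
    torus_integral mu (flow X tau psi) - torus_integral mu psi.
  exact: cvgB (cvg_mu _ (flow_Csharp0 b_C1 X_sol tau psiC)) (cvg_mu _ psiC).
apply/eqP; rewrite -subr_eq0 -(cvg_lim (@Rhausdorff R) D_cvg); apply/eqP.
apply: cvg_lim => //.
have t_inv : (t n)^-1 @[n --> F] --> 0.
  by apply/(gtr0_cvgV0 t_gt0); apply: cvg_trans t_oo => B /ooF.
have bound0 : (t n)^-1 * (2 * (M * `|tau|)) @[n --> F] --> 0.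
  rewrite -[X in _ --> X](mul0r (2 * (M * `|tau|))).
  by apply: cvgM => //; exact: cvg_cst.
apply/norm_cvg0P.
apply: (squeeze_cvgr _ (cvg_cst 0) bound0).
apply: filterS t_gt0 => n tn; rewrite normr_ge0/= /D.
have -> : (fun s => flow X tau psi (X s x)) = (fun s => psi (X (s + tau) x)).
  by apply/funext => s; rewrite /flow -(flow_semigroup b_C1 X_sol) addrC.
apply: (@time_average_shift _ _ _ _ (fun s => psi (X s x))) => //.
by move=> s; apply: continuous_comp; [exact: (orbit_continuous X_sol)|exact: cpsi].
Qed.

End orbit_averages.

Theorem proposition2p1 (R : realType) (d : nat) (d_ge1 : (1 <= d)%N)
    (b : 'rV[R]_d -> 'rV[R]_d) (b_C1 : Csharp_vec 1 b)
    (X : R -> 'rV[R]_d -> 'rV[R]_d) (X_sol : is_solution b X) :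
  (exists mu : probability (borel_torus R d) R, invariant_measure X mu) /\
  (forall (g : 'rV[R]_d -> R) (x : 'rV[R]_d) (t : R^nat),
    Csharp 0 g ->
    t @ \oo --> +oo ->
    forall a : R,
      subsequential_limit
        (fun n => (t n)^-1 * oriented_integral 0 (t n) (fun s => g (X s x))) a ->
      exists mu : probability (borel_torus R d) R,
        invariant_measure X mu /\ a = torus_integral mu g).
Proof.
split.
  have [mu [inv_mu _]] := invariant_measure_of_averages b_C1 X_sol 0 (@cvgr_idn R).
  by exists mu.
move=> g x t gC t_oo a [phi phi_incr u_a].
have phi_oo : phi n @[n --> \oo] --> \oo by exact: increasing_seq_cvgy.
have tphi_oo : (t \o phi) n @[n --> \oo] --> +oo by exact: cvg_comp t_oo.
have [mu [inv_mu muE]] := invariant_measure_of_averages b_C1 X_sol x tphi_oo.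
exists mu; split=> //; apply: muE => //; apply: cvg_trans u_a.
apply: near_eq_cvg; have tphi_ge0 : \forall n \near \oo, 0 <= (t \o phi) n.
  by move/cvgryPge: tphi_oo; apply.
near=> n; have tn : 0 <= (t \o phi) n by near: n.
by rewrite /time_average /oriented_integral/= tn.
Unshelve. all: by end_near. Qed.
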